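(* Let $F_n$ be the free group on $n \geq 2$ generators. Let $\{H_i\alpha_i\}_{i=1}^{s}$ be a coset partition of $F_n$ with $H_i<F_n$ of index $d_i$, $\alpha_i \in F_n$, $1 \leq i \leq s$, and $1<d_1 \leq \dots\leq d_s$. Let $T_i$ be the transition group of $H_i$, $1\le i\le s$. If there exists a $d_s$-cycle in $T_s$, then the index $d_s$ appears in the partition at least $p$ times (i.e. $|\{i : 1\le i\le s,\ d_i=d_s\}|\ge p$), where $p$ is the smallest prime dividing $d_s$. Furthermore, all the subgroups $H_i$ with the same index are isomorphic.
   Context: A coset partition of a group $G$ is a finite family $\{H_i\alpha_i\}_{i=1}^{s}$ of right cosets of subgroups $H_i\le G$ ($\alpha_i\in G$) that are pairwise disjoint and whose union is $G$; here all $H_i$ have finite index. For $H<F_n$ of finite index $d$, the Schreier graph of $H$ has as vertices the $d$ right cosets of $H$ and an edge $Hg\xrightarrow{a}Hga$ for each free generator $a$ of $F_n$. The transition group $T$ of $H$ (of its Schreier graph) is the image of $F_n$ in the symmetric group on the $d$ right cosets of $H$ (identified with a subgroup of $S_d$) under the action by right multiplication. A $d_s$-cycle in $T_s\le S_{d_s}$ is a permutation consisting of a single cycle of length $d_s$. *)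

(* Defs.v *)
From HB Require Import structures.
From mathcomp Require Import all_boot all_fingroup finmap.
From mathcomp Require Import boolp classical_sets functions cardinality.

Set Implicit Arguments.
Unset Strict Implicit.
Unset Printing Implicit Defensive.

Import GroupScope.
Local Open Scope classical_set_scope.
Local Open Scope card_scope.

(* [(i, false)] stands for the i-th generator, [(i, true)] for its inverse. *)
Notation letter n := ('I_n * bool)%type.

Definition inv_letter (n : nat) (x : letter n) : letter n := (x.1, ~~ x.2).

Definition reduced (n : nat) (w : seq (letter n)) : bool :=
  sorted (fun x y => y != inv_letter x) w.

(* The product of two reduced words is their concatenation followed by free
   reduction, performed one letter at a time by [push]. *)
Definition push (n : nat) (x : letter n) (w : seq (letter n)) :
    seq (letter n) :=
  if w is y :: w' then (if y == inv_letter x then w' else x :: w) else [:: x].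

Section FreeGroup.
Variable n : nat.
Implicit Types (x y : letter n) (u v w : seq (letter n)).

Record free_group : Type := FreeGroup {
  word :> seq (letter n);
  word_reduced : reduced word
}.
HB.instance Definition _ := [isSub for word].
HB.instance Definition _ := [Choice of free_group by <:].

Lemma inv_letterK : involutive (@inv_letter n).
Proof. by case=> i b; rewrite /inv_letter /= negbK. Qed.

Lemma reduced_push x w : reduced w -> reduced (push x w).
Proof.
case: w => [|y w] //= yw.
case: eqP => [_|/eqP yx]; first exact: path_sorted yw.
by rewrite /= yx.
Qed.

Lemma reduced_foldr u v : reduced v ->
  reduced (foldr (@push n) v u).
Proof. by move=> rv; elim: u => //= x u; apply: reduced_push. Qed.

Lemma push_inv x w : reduced w -> push x (push (inv_letter x) w) = w.
Proof.
case: w => [|y w] /=; first by rewrite eqxx.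
rewrite inv_letterK; case: eqP => [->|_ _]; last by rewrite /= eqxx.
by case: w => [|z w] //= /andP[/negPf -> _].
Qed.

Lemma reduced_inv w : reduced w -> reduced (rev (map (@inv_letter n) w)).
Proof.
rewrite /reduced rev_sorted sorted_map; apply: sub_sorted => x y /=.
by apply: contraNN => /eqP ->; rewrite !inv_letterK.
Qed.

Definition fg_one : free_group := @FreeGroup [::] isT.
Definition fg_mul (u v : free_group) : free_group :=
  FreeGroup (reduced_foldr u (word_reduced v)).
Definition fg_inv (u : free_group) : free_group :=
  FreeGroup (reduced_inv (word_reduced u)).

Lemma foldr_push x u w : reduced u -> reduced w ->
  foldr (@push n) w (push x u) = push x (foldr (@push n) w u).
Proof.
case: u => [|y u] //= _ rw; case: eqP => [->|] //=.
by rewrite push_inv // reduced_foldr.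
Qed.

Lemma fg_mulA : associative fg_mul.
Proof.
case=> u ru [v rv] [w rw]; apply: val_inj => /= {ru}.
elim: u => //= x u ->.
by rewrite foldr_push ?reduced_foldr.
Qed.

Lemma fg_mul1 : left_id fg_one fg_mul.
Proof. by move=> u; apply: val_inj. Qed.

Lemma foldr_push_nil w : reduced w -> foldr (@push n) [::] w = w.
Proof.
elim: w => //= x w IHw xw; rewrite (IHw (path_sorted xw)).
by case: w xw {IHw} => [|y w] //= /andP[/negPf -> _].
Qed.

Lemma fg_mulr1 : right_id fg_one fg_mul.
Proof. by move=> u; apply: val_inj; apply: foldr_push_nil (word_reduced u). Qed.

Lemma foldr_inv w v : reduced v ->
  foldr (@push n) (foldr (@push n) v w) (rev (map (@inv_letter n) w)) = v.
Proof.
elim: w v => //= x w IHw v rv; rewrite rev_cons foldr_rcons.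
have := push_inv (inv_letter x) (reduced_foldr w rv).
by rewrite inv_letterK => ->; apply: IHw.
Qed.

Lemma fg_mulV : left_inverse fg_one fg_inv fg_mul.
Proof.
move=> u; apply: val_inj => /=.
have := @foldr_inv (word u) [::] isT.
by rewrite (foldr_push_nil (word_reduced u)).
Qed.

Lemma fg_invK : involutive fg_inv.
Proof.
move=> u; apply: val_inj => /=.
by rewrite map_rev revK -map_comp map_id_in // => x _ /=; rewrite inv_letterK.
Qed.

Lemma fg_mulrV : right_inverse fg_one fg_inv fg_mul.
Proof. by move=> u; rewrite -{1}(fg_invK u) fg_mulV. Qed.

HB.instance Definition _ := isGroup.Build free_group
  fg_mulA fg_mul1 fg_mulr1 fg_mulV fg_mulrV.

Definition fg_gen (i : 'I_n) : free_group := @FreeGroup [:: (i, false)] isT.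

End FreeGroup.

Section Universal.
Variables (n : nat) (G : groupType) (f : 'I_n -> G).

Definition eval_letter (x : letter n) : G := if x.2 then (f x.1)^-1 else f x.1.

Definition eval_word (w : seq (letter n)) : G :=
  foldr (fun x g => eval_letter x * g) 1 w.

Lemma eval_letterV x : eval_letter (inv_letter x) = (eval_letter x)^-1.
Proof. by case: x => i []; rewrite /eval_letter //= invgK. Qed.

Lemma eval_push x w : eval_word (push x w) = eval_letter x * eval_word w.
Proof.
case: w => [|y w] //=; case: eqP => [->|] //=.
by rewrite eval_letterV mulVKg.
Qed.

Lemma eval_foldr u v :
  eval_word (foldr (@push n) v u) = eval_word u * eval_word v.
Proof. by elim: u => [|x u IHu] /=; rewrite ?mul1g // eval_push IHu mulgA. Qed.

Lemma free_group_universal :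
  exists2 phi : {multiplicative free_group n -> G},
    forall i, phi (fg_gen i) = f i &
    forall psi : {multiplicative free_group n -> G},
      (forall i, psi (fg_gen i) = f i) -> psi =1 phi.
Proof.
pose ev (u : free_group n) := eval_word u.
have evM : {morph ev : x y / x * y} by move=> u v; apply: eval_foldr.
pose evm := isMultiplicative.Build _ _ ev evM.
exists (HB.pack_for {multiplicative free_group n -> G} ev evm).
  by move=> i; rewrite /= /ev /= /eval_letter /= mulg1.
move=> psi psiE [w rw] /=; rewrite /ev /=.
have psi1 : psi 1 = 1.
  by apply: (mulgI (psi 1)); rewrite -gmulfM !mulg1.
have psiV g : psi g^-1 = (psi g)^-1.
  by apply: (mulgI (psi g)); rewrite -gmulfM !mulgV.
elim: w rw => [|x w IHw] rxw.
  by rewrite -[RHS]psi1; congr (psi _); apply: val_inj.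
have rw : reduced w := path_sorted rxw.
have rx : reduced [:: x] by [].
have -> : FreeGroup rxw = FreeGroup rx * FreeGroup rw.
  apply: val_inj => /=.
  by case: w rxw {IHw rw} => [|y w] //= /andP[/negPf -> _].
rewrite gmulfM IHw /=; congr (_ * _).
case: x rx {rxw} => i b rx; rewrite /eval_letter /=; case: b rx => rx.
  rewrite -psiE -psiV; congr (psi _); exact: val_inj.
by rewrite -psiE; congr (psi _); apply: val_inj.
Qed.

End Universal.

Definition is_subgroup (G : groupType) (H : set G) : Prop :=
  group_closed [in H].

Definition right_coset (G : groupType) (H : set G) (g : G) : set G :=
  [set h * g | h in H].

Lemma right_coset1 (G : groupType) (A : set G) : right_coset A 1 = A.
Proof.
rewrite /right_coset -[RHS]image_id; apply: eq_imagel => h _.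
exact: mulg1.
Qed.

Lemma right_cosetM (G : groupType) (A : set G) g w :
  right_coset (right_coset A g) w = right_coset A (g * w).
Proof.
rewrite /right_coset image_comp; apply: eq_imagel => h _ /=.
by rewrite mulgA.
Qed.

Definition right_cosets (G : groupType) (H : set G) : set (set G) :=
  range (right_coset H).

Definition has_index (G : groupType) (H : set G) (d : nat) : Prop :=
  right_cosets H #= `I_d.

(* Isomorphism of subgroups; the values of [f] outside [H] are irrelevant. *)
Definition isomorphic (G : groupType) (H K : set G) : Prop :=
  exists2 f : G -> G, set_bij H K f & {in H &, {morph f : x y / x * y}}.

(* The vertices of the Schreier graph of [H], i.e. its right cosets, as a
   finite type; meaningful for [H] of finite
   index only ([fset_set] returns the empty set on infinite sets). *)
Definition vertex (G : groupType) (H : set G) : finType :=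
  fset_set (right_cosets H).

Section Transition.
Variables (G : groupType) (H : set G).

Lemma right_coset_vertex (C : vertex H) w :
  right_coset (val C) w \in fset_set (right_cosets H).
Proof.
case: (pselect (finite_set (right_cosets H))) => [Hfin|Hinf].
  have := valP C; rewrite !in_fset_set // !inE => -[g _ Cg].
  by exists (g * w) => //; rewrite -Cg right_cosetM.
case: C => C /= CH; exfalso; move: CH.
by rewrite /fset_set; case: pselect.
Qed.

Definition vertex_mul (w : G) (C : vertex H) : vertex H :=
  [` right_coset_vertex C w]%fset.

Lemma vertex_mul_inj w : injective (vertex_mul w).
Proof.
move=> C D /(congr1 val) /= /(congr1 (fun A => right_coset A w^-1)) CD.
by apply: val_inj; move: CD; rewrite !right_cosetM mulgV !right_coset1.
Qed.

Definition transition_perm (w : G) : {perm vertex H} :=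
  perm (@vertex_mul_inj w).

Lemma transition_permM : {morph transition_perm : u v / u * v}.
Proof.
move=> u v; apply/permP => C; rewrite permM !permE; apply: val_inj => /=.
by rewrite right_cosetM.
Qed.

Definition transition_set : {set {perm vertex H}} :=
  [set t | `[< range transition_perm t >]]%SET.

Lemma transition_group_set : group_set transition_set.
Proof.
apply/group_setP; split.
  rewrite finset.in_set; apply/asboolP; exists 1 => //.
  by apply: (mulgI (transition_perm 1)); rewrite -transition_permM !mulg1.
move=> s t; rewrite !finset.in_set => /asboolP[u _ <-] /asboolP[v _ <-].
by apply/asboolP; exists (u * v) => //; rewrite transition_permM.
Qed.

Definition transition_group : {group {perm vertex H}} :=
  Group transition_group_set.

End Transition.

(* A single cycle of length [k], all other points being fixed; for
   [k = #|X|] the permutation moves every point around one cycle. *)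
Definition is_cycle (X : finType) (k : nat) (t : {perm X}) : Prop :=
  exists2 x : X, #|porbit t x| = k & perm_on (porbit t x) t.

(* Main.v *)
Require Import Defs.
From mathcomp Require Import all_boot all_fingroup all_algebra finmap.
From mathcomp Require Import boolp classical_sets functions cardinality.

(* Let [w] map to a [d_s]-cycle. For each [i], the [k] with [w^k] in
   [H_i alpha_i] form a residue class (or are none) modulo the length [m_i] of a
   cycle of [w] on the cosets of [H_i], and these classes partition the natural
   numbers. As [m_i <= d_i <= d_s] and [m_s = d_s], it suffices that in a disjoint
   covering system the largest modulus [d] occurs at least [p] times, where [p]
   is the least prime divisor of [d]. Summing the indicator functions over windows
   of step [d], then applying all the operators [f(x + d/q) - f(x)] for [q] a prime
   divisor of [d], kills every class with modulus other than [d]; so the indicator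
   function of the union of the classes with modulus [d] is killed too, and
   this forces it to have at least [p] points modulo [d].

   Subgroups of the same index [d] are isomorphic because both are free of rank
   [d(n - 1) + 1]: the edges outside a spanning tree of the Schreier graph form a
   basis, the coordinates of an element being read off along the closed path that
   it labels. *)

Set Implicit Arguments.
Unset Strict Implicit.
Unset Printing Implicit Defensive.

(** * Finite differences of periodic functions *)

Section Differences.
Variable V : zmodType.
Implicit Types (f g : nat -> V) (a m x y : nat) (s : seq nat).

Definition periodic m f := forall x, f (x + m)%N = f x.

Definition diff a f : nat -> V := fun x => (f (x + a)%N - f x)%R.

Definition diffs s f : nat -> V := foldr diff f s.

Lemma periodicM m f k x : periodic m f -> f (x + k * m)%N = f x.
Proof. by move=> fm; elim: k => [|k IHk]; rewrite ?addn0 // mulSnr addnA fm. Qed.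

Lemma periodic_dvd m k f : m %| k -> periodic m f -> periodic k f.
Proof. by move=> /dvdnP[j ->] fm x; rewrite periodicM. Qed.

Lemma periodic_gcdn m k f :
  0 < m -> periodic m f -> periodic k f -> periodic (gcdn m k) f.
Proof.
move=> m_gt0 fm fk x; case: (egcdnP k m_gt0) => u v uv _.
(* Bezout over the naturals reads [u * m = v * k + gcdn m k], so a shift by [v * k] is added
   first. *)
by rewrite -(periodicM v _ fk) -addnA [(gcdn _ _ + _)%N]addnC -uv periodicM.
Qed.

Lemma periodic_diffs m s f : periodic m f -> periodic m (diffs s f).
Proof. by move=> fm; elim: s => //= a s IHs x; rewrite /diff addnAC !IHs. Qed.

Lemma diffs_eq0 a s f x : a \in s -> periodic a f -> diffs s f x = 0%R.
Proof.
move=> + fa; elim: s x => //= b s IHs x.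
rewrite in_cons; case: eqP => [<- _|_ /= /IHs s0].
  by rewrite /diff periodic_diffs // GRing.subrr.
by rewrite /diff !s0 GRing.subrr.
Qed.

Lemma diffs_sum (I : finType) (P : pred I) s (F : I -> nat -> V) x :
  diffs s (fun y => \sum_(i | P i) F i y)%R x = (\sum_(i | P i) diffs s (F i) x)%R.
Proof. by elim: s x => //= a s IHs x; rewrite /diff !IHs -GRing.sumrB. Qed.

Lemma diffs_mulrn s f k x : diffs s (fun y => f y *+ k)%R x = (diffs s f x *+ k)%R.
Proof. by elim: s x => //= a s IHs x; rewrite /diff !IHs GRing.mulrnBl. Qed.

(** A nonzero difference has a nonzero term, and both terms are taken at points congruent modulo
    [e]. *)
Lemma diffs_neq0 s f x e : (forall a, a \in s -> e %| a) -> diffs s f x != 0%R ->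
  exists2 y, f y != 0%R & y = x %[mod e].
Proof.
elim: s x => [|a s IHs] x es /=; first by exists x.
have {}IHs := IHs _ (fun b bs => es b (mem_behead (s := a :: s) bs)).
have [|/eqP] := eqVneq (diffs s f (x + a)%N) 0%R; last first.
  move=> /eqP /IHs[y fy yx] _; exists y => //; rewrite yx.
  have /dvdnP[k ->] := es a (mem_head a s).
  by rewrite addnC modnMDl.
by rewrite /diff => -> fx; apply: IHs; apply: contraNneq fx => ->; rewrite GRing.subr0.
Qed.

(* A [q :: s]-difference vanishing while the [s]-difference [g] does not makes
   [g] invariant under [d/q]. Each of the [q] nonzero values of [g] on an orbit of
   this shift needs a nonzero value of [f] at a congruent point modulo the [q]-part
   of [d], and these [q] points are distinct. *)
Lemma diffs_support d s f : 0 < d -> periodic d f -> uniq s ->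
  (forall q, q \in s -> prime q && (q %| d)) -> (exists x, f x != 0%R) ->
  (forall x, diffs [seq d %/ q | q <- s] f x = 0%R) ->
  pdiv d <= #|[pred x : 'I_d | f x != 0%R]|.
Proof.
move=> d_gt0 fd; elim: s => [|q s IHs] /=; first by move=> _ _ [x /eqP fx] /(_ x).
move=> /andP[qs us] sd fN0 dqs0.
have sd' r : r \in s -> prime r && (r %| d) by move=> rs; apply: sd; rewrite mem_behead.
set g := diffs [seq d %/ r | r <- s] f in dqs0.
have [g0|/existsNP[x /eqP gx]] := pselect (forall x, g x = 0%R); first exact: IHs.
have /andP[qP qd] : prime q && (q %| d) by apply: sd; rewrite mem_head.
have gq : periodic (d %/ q) g.
  by move=> y; apply/eqP; rewrite -GRing.subr_eq0; apply/eqP; apply: dqs0.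
set v := logn q d.
have qvd : q ^ v %| d by apply: pfactor_dvdnn.
have qv_dvd r : r \in s -> q ^ v %| d %/ r.
  move=> rs; have /andP[rP rd] := sd' r rs.
  have qr : coprime (q ^ v) r.
    rewrite coprimeXl // prime_coprime // dvdn_prime2 //.
    by apply: contraNneq qs => ->.
  by rewrite -(Gauss_dvdr _ qr) [(r * _)%N]mulnC divnK.
have yP (j : 'I_q) : exists y : 'I_d, f y != 0%R /\ y = (x + j * (d %/ q))%N %[mod q ^ v].
  have gj : g (x + j * (d %/ q))%N != 0%R by rewrite periodicM.
  have [|y fy yx] := @diffs_neq0 _ _ _ (q ^ v) _ gj.
    by move=> a /mapP[r rs ->]; apply: qv_dvd.
  have yd : y %% d < d by rewrite ltn_mod.
  exists (Ordinal yd); split=> /=.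
    by rewrite -(periodicM (y %/ d) _ fd) addnC -divn_eq.
  by rewrite modn_dvdm.
pose y j := projT1 (cid (yP j)).
have fy j : f (y j) != 0%R by rewrite /y; case: cid => ? [].
have yE j : y j = (x + j * (d %/ q))%N %[mod q ^ v] by rewrite /y; case: cid => ? [].
have y_inj : injective y.
  move=> i j; wlog ij : i j / i <= j.
    by move=> IH; case: (leqP i j) => [/IH //|/ltnW/IH + /esym] => /[apply].
  move=> yij; have /eqP := yE j; rewrite -yij yE eqn_modDl eq_sym.
  rewrite eqn_mod_dvd ?leq_mul2r ?ij ?orbT // -mulnBl.
  (* Multiplied by [q], the congruence says that [q ^ v.+1] divides [(j - i) * d]; hence [q] divides
     [j - i], which is smaller than [q]. *)
  rewrite -(dvdn_pmul2r (prime_gt0 qP)) -mulnA divnK // -expnSr => qv.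
  apply/val_inj/eqP; rewrite /= eqn_leq ij /=.
  apply: contraTT qv; rewrite -ltnNge => lt_ij.
  have ji_gt0 : 0 < j - i by rewrite subn_gt0.
  rewrite pfactor_dvdn ?muln_gt0 ?ji_gt0 // lognM // -add1n leq_add2r.
  rewrite -(pfactor_dvdn 1) //.
  by rewrite gtnNdvd // (leq_ltn_trans (leq_subr _ _)).
apply: (@leq_trans q); first exact: pdiv_min_dvd (prime_gt1 qP) qd.
rewrite -[q in q <= _]card_ord -(card_imset _ y_inj); apply: subset_leq_card.
by apply/fintype.subsetP=> _ /imsetP[j _ ->]; rewrite inE.
Qed.

(** * Window sums and disjoint covering systems *)

Definition window_sum d k f : nat -> V := fun x => (\sum_(j < k) f (x + j * d)%N)%R.

Lemma periodic_window_sum d k m f : periodic m f -> periodic m (window_sum d k f).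
Proof. by move=> fm x; apply: eq_bigr => j _; rewrite addnAC fm. Qed.

Lemma window_sum_periodic d k f : periodic (k * d)%N f -> periodic d (window_sum d k f).
Proof.
move=> fkd x; rewrite /window_sum; case: k fkd => [|k] fkd; first by rewrite !big_ord0.
rewrite [LHS]big_ord_recr [RHS]big_ord_recl [LHS]GRing.addrC mul0n addn0 /=.
congr (_ + _)%R.
  by rewrite -addnA -mulSn fkd.
by apply: eq_bigr => j _; rewrite -addnA -mulSn.
Qed.

Lemma window_sum_id d k f x : periodic d f -> window_sum d k f x = (f x *+ k)%R.
Proof.
move=> fd; rewrite -[k in RHS]card_ord -GRing.sumr_const.
by apply: eq_bigr => j _; rewrite periodicM.
Qed.

(** The window sum has both periods [m] and [d], hence also [g = gcdn m d], a proper divisor of [d].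
    For a prime [q] dividing [d / g], [g] divides [d / q], and the difference with step [d / q]
    vanishes. *)
Lemma diffs_window_sum_eq0 d k m f x : 0 < d -> 0 < m -> ~~ (d %| m) ->
  m %| k * d -> periodic m f ->
  diffs [seq d %/ q | q <- primes d] (window_sum d k f) x = 0%R.
Proof.
move=> d_gt0 m_gt0 dm mkd fm.
set g := gcdn m d; have gd : g %| d := dvdn_gcdr m d.
have g_gt0 : 0 < g := dvdn_gt0 d_gt0 gd.
have [e dE] := dvdnP gd.
have e_gt1 : 1 < e.
  rewrite ltn_neqAle eq_sym; apply/andP; split.
    by apply: contraNneq dm => e1; rewrite dE e1 mul1n dvdn_gcdl.
  by move: d_gt0; rewrite dE muln_gt0 => /andP[].
have qP := pdiv_prime e_gt1; have qe := pdiv_dvd e.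
apply: (@diffs_eq0 (d %/ pdiv e)).
  by apply: map_f; rewrite mem_primes qP d_gt0 dE dvdn_mulr.
apply: (@periodic_dvd g).
  by rewrite dE -divn_mulAC // dvdn_mull.
apply: periodic_gcdn => //; first exact: periodic_window_sum.
by apply: window_sum_periodic; apply: (periodic_dvd mkd).
Qed.

End Differences.

(** Maximality of [m i0] is for divisibility: a modulus other than [m i0] is not a multiple of it,
    so the window sum of its class is killed. *)
Lemma disjoint_cover_max_modulus (I : finType) (A : {set I}) (m r : I -> nat) i0 :
  (forall i, i \in A -> 0 < m i) ->
  (forall x, #|[pred i in A | x == r i %[mod m i]]| = 1) ->
  i0 \in A -> 1 < m i0 -> (forall i, i \in A -> m i0 %| m i -> m i = m i0) ->
  pdiv (m i0) <= #|[pred i in A | m i == m i0]|.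
Proof.
move=> m_gt0 cover Ai0 d_gt1 m_max; set d := m i0 in d_gt1 m_max *.
have d_gt0 : 0 < d by apply: ltnW.
pose F i x : int := ((x == r i %[mod m i])%:R)%R.
have Fm i : periodic (m i) (F i) by move=> x; rewrite /F modnDr.
have FA x : (\sum_(i in A) F i x)%R = 1%R.
  rewrite /F -GRing.natr_sum; rewrite -[RHS]/((1%N)%:R)%R.
  congr ((_ : nat)%:R)%R; rewrite -(cover x) -sum1_card [RHS]big_mkcondr /=.
  by apply: eq_bigr => i _; case: eqP.
pose S := [pred i in A | m i == d].
pose f x : int := (\sum_(i | S i) F i x)%R.
pose N := \prod_(i in A) m i.
have N_gt0 : 0 < N by apply: prodn_cond_gt0.
have mN i : i \in A -> m i %| N by move=> Ai; rewrite /N (bigD1 i) //= dvdn_mulr.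
have NE : N = (N %/ d * d)%N by rewrite divnK // mN.
have fd : periodic d f.
  by move=> x; apply: eq_bigr => i /andP[_ /eqP <-]; apply: Fm.
pose ds := [seq d %/ q | q <- primes d].
have ds_f x : diffs ds f x = 0%R.
  have k_gt0 : 0 < N %/ d by rewrite divn_gt0 // dvdn_leq // mN.
  pose W i := window_sum d (N %/ d) (F i).
  have W_S : (\sum_(i | S i) diffs ds (W i) x = diffs ds f x *+ (N %/ d))%R.
    rewrite diffs_sum -GRing.sumrMnl; apply: eq_bigr => i /andP[_ /eqP mi].
    rewrite -diffs_mulrn; congr diffs; apply/funext => y.
    by rewrite /W window_sum_id // -mi.
  (* The indicators add up to the constant 1, which a single difference kills; [pdiv d] supplies one
     since [d > 1]. *)
  have W_A : (\sum_(i in A) diffs ds (W i) x = 0)%R.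
    rewrite -diffs_sum; apply: (@diffs_eq0 _ (d %/ pdiv d)).
      by apply: map_f; rewrite mem_primes pdiv_prime // d_gt0 pdiv_dvd.
    move=> y; rewrite /W /window_sum exchange_big [RHS]exchange_big /=.
    by apply: eq_bigr => j _; rewrite !FA.
  apply/eqP; have := erefl (diffs ds f x *+ (N %/ d))%R; rewrite -{1}W_S.
  move: W_A; rewrite (bigID (fun i => m i == d)) /= [X in (_ + X)%R]big1 ?GRing.addr0.
    by move=> -> /esym/eqP; rewrite Num.Theory.mulrn_eq0 -leqn0 leqNgt k_gt0.
  move=> i /andP[Ai mid].
  apply: (@diffs_window_sum_eq0 _ _ _ (m i)) => //; first exact: m_gt0.
    by apply: contra mid => /(m_max i Ai) ->.
  by rewrite -NE mN.
have fN0 : exists x, f x != 0%R.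
  exists (r i0); rewrite /f (bigD1 i0) ?inE ?Ai0 ?eqxx //= /F eqxx.
  rewrite Num.Theory.lt0r_neq0 // Num.Theory.ltr_pwDl //.
  by apply: Num.Theory.sumr_ge0 => i _; apply: Num.Theory.ler0n.
have pP q : q \in primes d -> prime q && (q %| d).
  by rewrite mem_primes => /and3P[-> _ ->].
apply: leq_trans (diffs_support d_gt0 fd (primes_uniq d) pP fN0 ds_f) _.
(* Every residue modulo [d] where [f] is nonzero is that of some [r i] with [i] in [S]. *)
pose g i : 'I_d := Ordinal (ltn_pmod (r i) d_gt0).
apply: leq_trans (leq_image_card g S); apply: subset_leq_card.
apply/fintype.subsetP => x; rewrite inE => fx.
have [i /andP[Si xi]|nS] := pickP (fun i => S i && (x == r i %[mod d])); last first.
  case/negP: fx; apply/eqP; apply: big1 => i /[dup] Si /andP[_ /eqP mi].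
  by have := nS i; rewrite Si /= /F mi => ->.
have -> : x = g i by apply: val_inj; rewrite /= -(eqP xi) modn_small.
by apply/fintype.imageP; exists i.
Qed.

Import GroupScope.

(** * Cocycles and spanning trees of Schreier graphs *)

Definition fg_letter n (l : letter n) : free_group n :=
  if l.2 then (fg_gen l.1)^-1 else fg_gen l.1.

Lemma free_group_cons n (l : letter n) w (rlw : reduced (l :: w))
    (rw : reduced w) :
  FreeGroup rlw = fg_letter l * FreeGroup rw.
Proof.
apply: val_inj; case: l rlw => i [] /= rlw;
  case: w rw rlw => //= l w rw /andP[/negPf + _];
  by rewrite /inv_letter /= => ->.
Qed.

Lemma free_group_ind n (P : free_group n -> Prop) :
  P 1 -> (forall i, P (fg_gen i)) -> (forall u v, P u -> P v -> P (u * v)) ->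
  (forall u, P u -> P u^-1) -> forall u, P u.
Proof.
move=> P1 Pgen PM PV [w rw]; elim: w rw => [|l w IHw] rlw.
  by have -> : FreeGroup rlw = 1 by apply: val_inj.
rewrite (free_group_cons rlw (path_sorted rlw)); apply: PM => //.
by rewrite /fg_letter; case: l.2; [apply: PV|]; apply: Pgen.
Qed.

Section Schreier.
Variables (n : nat) (X : finType) (t : free_group n -> {perm X}).
Hypothesis tM : {morph t : u v / u * v}.

Lemma perm_rep1 : t 1 = 1.
Proof. by apply: (mulgI (t 1)); rewrite -tM !mulg1. Qed.

Lemma perm_repV u : t u^-1 = (t u)^-1.
Proof. by apply: (mulgI (t u)); rewrite -tM !mulgV perm_rep1. Qed.

Section Cocycle.
Variable K : groupType.

(** A functor from the action groupoid to [K]: [c x u] is the value of the path that starts at [x]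
    and reads [u]. *)
Definition cocycle (c : X -> free_group n -> K) :=
  forall x u v, c x (u * v) = c x u * c (t u x) v.

Lemma cocycle1 c x : cocycle c -> c x 1 = 1.
Proof.
move=> cM; apply: (mulgI (c x 1)).
by rewrite -{2}[x]perm1 -perm_rep1 -cM !mulg1. Qed.

Lemma cocycleV c x u : cocycle c -> c x u^-1 = (c (t u^-1 x) u)^-1.
Proof.
move=> cM; apply: (mulIg (c (t u^-1 x) u)).
by rewrite -cM !mulVg cocycle1.
Qed.

(** Multiply the edge labels along the path of the reduced word. Backtracking contributes 1, so free
    reduction does not change the product. *)
Lemma cocycle_universal (g : X * 'I_n -> K) :
  exists2 c, cocycle c & forall x i, c x (fg_gen i) = g (x, i).
Proof.
pose step x (l : letter n) := t (fg_letter l) x.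
(* An inverse letter traverses backwards the edge that starts at [step x l]. *)
pose gl x (l : letter n) := if l.2 then (g (step x l, l.1))^-1 else g (x, l.1).
pose fix cw x (w : seq (letter n)) : K :=
  if w is l :: w' then gl x l * cw (step x l) w' else 1.
have letterV l : fg_letter (inv_letter l) = (fg_letter l)^-1.
  by case: l => i []; rewrite /fg_letter /= ?invgK.
have stepV x l : step (step x l) (inv_letter l) = x.
  by rewrite /step letterV -permM -tM mulgV perm_rep1 perm1.
have glV x l : gl (step x l) (inv_letter l) = (gl x l)^-1.
  rewrite /gl stepV /=; case: l => i [] //=.
  by rewrite invgK.
have cw_push x l w : cw x (push l w) = gl x l * cw (step x l) w.
  case: w => [|y w] //=; case: eqP => [->|] //=.
  by rewrite glV stepV mulVKg.
have cw_foldr x u v : cw x (foldr (@push n) v u) = cw x u * cw (foldl step x u) v.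
  elim: u x => [|l u IHu] x /=; first by rewrite mul1g.
  by rewrite cw_push IHu mulgA.
have foldl_step x u : foldl step x (word u) = t u x.
  case: u => w rw /=; elim: w x rw => [|l w IHw] x rlw /=.
    have -> : FreeGroup rlw = 1 by apply: val_inj.
    by rewrite perm_rep1 perm1.
  by rewrite (free_group_cons rlw (path_sorted rlw)) (IHw _ (path_sorted rlw)) tM permM.
exists (fun x u => cw x (word u)).
  by move=> x u v /=; rewrite cw_foldr foldl_step.
by move=> x i; rewrite /= mulg1.
Qed.

End Cocycle.

Variable x0 : X.
Hypothesis trans : forall x, exists u, t u x0 = x.

(* The fields say that [E] is the edge set of a tree in the Schreier graph with
   vertex set [S], and that [tau x] labels the path from [x0] to [x] in it; the
   last one expresses that this path only uses edges in [E]. *)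
Record rooted_tree (S : {set X}) (E : {set X * 'I_n})
    (tau : X -> free_group n) : Prop := RootedTree {
  tree_root : x0 \in S;
  tree_tau_root : tau x0 = 1;
  tree_tau x : x \in S -> t (tau x) x0 = x;
  tree_edge x i : (x, i) \in E ->
    [/\ x \in S, t (fg_gen i) x \in S & tau (t (fg_gen i) x) = tau x * fg_gen i];
  tree_card : (#|E| + 1 = #|S|)%N;
  tree_cocycle (K : groupType) (c : X -> free_group n -> K) : cocycle c ->
    (forall x i, (x, i) \in E -> c x (fg_gen i) = 1) ->
    forall x, x \in S -> c x0 (tau x) = 1
}.

Lemma closed_setT (S : {set X}) : x0 \in S ->
  (forall x l, x \in S -> t (fg_letter l) x \in S) -> S = [set: X].
Proof.
move=> S0 SS; apply/setP => x; rewrite inE; have [[w rw] <-] := trans x.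
elim: w rw x0 S0 => [|l w IHw] rlw y Sy.
  have -> : FreeGroup rlw = 1 by apply: val_inj.
  by rewrite perm_rep1 perm1.
by rewrite (free_group_cons rlw (path_sorted rlw)) tM permM IHw // SS.
Qed.

Lemma rooted_tree_extend S E tau : rooted_tree S E tau -> S != [set: X] ->
  exists S' E' tau', rooted_tree S' E' tau' /\ #|S'| = #|S|.+1.
Proof.
move=> T ST.
have [x [l [Sx nSy]]] : exists x l, x \in S /\ t (fg_letter l) x \notin S.
  apply: contrapT => nex; case/negP: ST; apply/eqP/closed_setT; first exact: tree_root T.
  by move=> x l Sx; apply: contrapT => /negP nSy; apply: nex; exists x, l.
set y := t (fg_letter l) x in nSy.
(* The added edge is oriented along its generator, so it starts at [y] when [l] is an inverse. *)
pose e := (if l.2 then y else x, l.1).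
pose tau' z := if z == y then tau x * fg_letter l else tau z.
have nEe : e \notin E.
  apply: contra nSy; rewrite /e /y /fg_letter; case: l.2 => /(tree_edge T)[] //.
have tauS z : z \in S -> tau' z = tau z.
  by rewrite /tau'; case: eqP => // -> /(negP nSy).
have tau'y : tau' y = tau x * fg_letter l by rewrite /tau' eqxx.
have e_edge : exists2 z, e = (z, l.1) & tau' (t (fg_gen l.1) z) = tau' z * fg_gen l.1 /\
   z \in y |: S /\ t (fg_gen l.1) z \in y |: S.
  rewrite /e; case l2 : l.2; last first.
    exists x => //; move: (erefl y) tau'y; rewrite {1}/y /fg_letter l2 => ->.
    by rewrite (tauS x Sx) !inE eqxx Sx orbT.
  exists y => //; have yx : t (fg_gen l.1) y = x.
    by rewrite /y /fg_letter l2 perm_repV permKV.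
  by rewrite yx tau'y tauS // /fg_letter l2 mulgKV !inE eqxx Sx orbT.
exists (y |: S), (e |: E), tau'; split; last by rewrite cardsU1 nSy.
split.
- by rewrite !inE (tree_root T) orbT.
- by rewrite tauS ?(tree_tau_root T) ?(tree_root T).
- move=> z; rewrite !inE => /orP[/eqP ->|Sz]; last by rewrite tauS // (tree_tau T).
  by rewrite tau'y tM permM (tree_tau T).
- move=> z i; rewrite !inE => /orP[|Ezi]; last first.
    have [Sz Szi tz] := tree_edge T Ezi.
    by rewrite !tauS // Sz Szi !orbT.
  by case: e_edge => z' -> [h1 [h2 h3]] /eqP[-> ->]; move: h2 h3; rewrite !inE.
- by rewrite !cardsU1 nSy nEe -(tree_card T) addnA.
move=> K c cM cE z; have cS := tree_cocycle T cM (fun x i Exi => cE x i (setU1r e Exi)).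
rewrite !inE => /orP[/eqP ->|Sz]; last by rewrite tauS // cS.
rewrite tau'y cM cS // mul1g (tree_tau T) //; have := cE _ _ (setU11 e E).
rewrite /y /fg_letter; case: l.2 => // ce.
by rewrite cocycleV // ce invg1.
Qed.

Lemma spanning_tree : exists E tau, rooted_tree [set: X] E tau.
Proof.
have T0 : rooted_tree [set x0] finset.set0 (fun=> 1).
  split=> //.
  - by rewrite inE.
  - by move=> x; rewrite inE => /eqP ->; rewrite perm_rep1 perm1.
  - by move=> x i; rewrite finset.in_set0.
  - by rewrite cards0 cards1.
  - by move=> K c cM _ x _; apply: cocycle1.
have [k ltk] := ubnP (#|X| - #|[set x0]%SET|).
elim: k [set x0]%SET finset.set0 (fun=> 1) ltk T0 => // k IHk S E tau ltk T.
have [ST|ST] := eqVneq S [set: X]; first by exists E, tau; rewrite -ST.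
have [S' [E' [tau' [T' cS']]]] := rooted_tree_extend T ST.
apply: IHk T'; rewrite cS'.
have : #|S| < #|X| by rewrite -cardsT proper_card // properT.
by move=> ltS; rewrite subnS prednK ?subn_gt0.
Qed.

(** [psi] sends an edge outside the tree to the loop at [x0] through it, and [phi] records the edges
    outside the tree crossed by a path from [x0]. Multiplicativity of [phi] needs the first path to
    be closed. *)
Lemma schreier : exists k, (k + #|X| = #|X| * n + 1)%N /\
  exists (phi : free_group n -> free_group k) (psi : free_group k -> free_group n),
  [/\ forall u v, t u x0 = x0 -> phi (u * v) = phi u * phi v,
      {morph psi : u v / u * v}, forall v, t (psi v) x0 = x0, cancel psi phi &
      forall u, t u x0 = x0 -> psi (phi u) = u].
Proof.
have [E [tau T]] := spanning_tree.
exists #|~: E|; split.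
  have := tree_card T; rewrite cardsT => cX.
  by rewrite -{1}cX addnA -[(#|~: E| + _)%N]addnC cardsC card_prod card_ord.
(* Edges of the tree are not enumerated in [~: E] and get the default label 1. *)
pose g p :=
  if [pick j | enum_val j == p] is Some j then fg_gen j else 1 : free_group #|~: E|.
have gE p : p \in E -> g p = 1.
  rewrite /g; case: pickP => // j /eqP <- Ej.
  by have := enum_valP j; rewrite inE Ej.
have g_val j : g (enum_val j) = fg_gen j.
  rewrite /g; case: pickP => [i /eqP /enum_val_inj -> //|/(_ j)].
  by rewrite eqxx.
have [c cM cg] := cocycle_universal g.
pose p j : X * 'I_n := enum_val (j : 'I_#|~: E|).
have [psi psi_gen _] := free_group_universal
  (fun j => tau (p j).1 * fg_gen (p j).2 * (tau (t (fg_gen (p j).2) (p j).1))^-1).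
have psiM : {morph psi : u v / u * v} by apply: gmulfM.
have psi1 : psi 1 = 1 by apply: (mulgI (psi 1)); rewrite -psiM !mulg1.
have psiV u : psi u^-1 = (psi u)^-1.
  by apply: (mulgI (psi u)); rewrite -psiM !mulgV.
have tauT x : t (tau x) x0 = x by apply: tree_tau T _ _; rewrite inE.
have tauV x : t (tau x)^-1 x = x0.
  by rewrite perm_repV; apply: (canLR (permK _)); rewrite tauT.
have c_tau x : c x0 (tau x) = 1.
  by apply: (tree_cocycle T cM) => [y i Ey|]; rewrite ?inE // cg gE.
have t_psi v : t (psi v) x0 = x0.
  elim/free_group_ind: v => [|j|u v IHu IHv|u IHu].
  - by rewrite psi1 perm_rep1 perm1.
  - by rewrite psi_gen !tM !permM tauT tauV.
  - by rewrite psiM tM permM IHu.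
  - by rewrite psiV perm_repV -{1}IHu permK.
(* The induction moves the starting point, hence any [x]. At [x0], with [u] fixing [x0], both [tau]
   factors are 1. *)
have psi_c u x : psi (c x u) = tau x * u * (tau (t u x))^-1.
  elim/free_group_ind: u x => [|i|u v IHu IHv|u IHu] x.
  - by rewrite cocycle1 // perm_rep1 perm1 mulg1 mulgV psi1.
  - rewrite cg; have [Exi|nExi] := boolP ((x, i) \in E).
      by rewrite gE // psi1; have [_ _ ->] := tree_edge T Exi; rewrite mulgV.
    have [j xi] : exists j, (x, i) = p j.
      have nE : (x, i) \in ~: E by rewrite inE.
      by exists (enum_rank_in nE (x, i)); rewrite /p enum_rankK_in.
    by rewrite xi g_val psi_gen -xi.
  - by rewrite cM psiM IHu IHv tM permM !mulgA mulgKV.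
  - by rewrite cocycleV // psiV IHu !invMg invgK -permM -tM mulVg perm_rep1 perm1 mulgA.
exists (c x0), psi; split=> //.
- by move=> u v ux; rewrite cM ux.
- move=> v; elim/free_group_ind: v => [|j|u v IHu IHv|u IHu].
  + by rewrite psi1 cocycle1.
  + rewrite psi_gen !cM c_tau mul1g cg tauT !tM !permM tauT cocycleV //.
    by rewrite tauV c_tau invg1 mulg1 -surjective_pairing g_val.
  + by rewrite psiM cM t_psi IHu IHv.
  + by rewrite psiV cocycleV // -psiV t_psi IHu.
by move=> u ux; rewrite psi_c ux (tree_tau_root T) mul1g invg1 mulg1.
Qed.

End Schreier.

(** * Orbits of a permutation, and cosets as vertices *)

Lemma porbit_expgE (X : finType) (t : {perm X}) x k l :
  ((t ^+ k) x == (t ^+ l) x) = (k == l %[mod #|porbit t x|]).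
Proof.
have m_gt0 : 0 < #|porbit t x| by rewrite lt0n card_porbit_neq0.
have modE j : (t ^+ j) x = nth x (traject t x #|porbit t x|) (j %% #|porbit t x|).
  rewrite nth_traject ?ltn_mod // permX [in LHS](divn_eq j #|porbit t x|) addnC iterD.
  by congr iter; elim: (j %/ _)%N => //= q IHq; rewrite mulSn iterD IHq iter_porbit.
by rewrite !modE nth_uniq ?uniq_traject_porbit // size_traject ltn_mod.
Qed.

Lemma card_cycle_porbit (X : finType) (t : {perm X}) x :
  is_cycle #|X| t -> #|porbit t x| = #|X|.
Proof.
move=> [y ty _]; suff -> : porbit t x = porbit t y by [].
have /setP/(_ x) : porbit t y = [set: X]%SET.
  by apply/eqP; rewrite eqEcard finset.subsetT cardsT ty leqnn.
by rewrite finset.in_setT -eq_porbit_mem => /eqP.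
Qed.

Section Subgroup.
Variables (G : groupType) (H : set G).
Hypothesis Hgrp : is_subgroup H.

Lemma subgroup1 : H 1.
Proof. by have [] := Hgrp; rewrite inE. Qed.

Lemma subgroup_div u v : H u -> H v -> H (u * v^-1).
Proof. by have [_ Hd] := Hgrp => Hu Hv; have := Hd u v; rewrite !inE; apply. Qed.

Lemma right_coset_eq u v : right_coset H u = right_coset H v <-> right_coset H v u.
Proof.
have HM a b : H a -> H b -> H (a * b).
  move=> Ha Hb; rewrite -[b]invgK -[b^-1]mul1g.
  by apply: subgroup_div => //; apply: subgroup_div => //; apply: subgroup1.
split=> [<-|[h Hh <-]]; first by exists 1; [apply: subgroup1|rewrite mul1g].
rewrite -right_cosetM; congr right_coset; apply/seteqP; split=> [_ [k Hk <-]|k Hk].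
  exact: HM.
by exists (k * h^-1); [apply: subgroup_div|rewrite mulgKV].
Qed.

Section FiniteIndex.
Variable d : nat.
Hypothesis Hd : has_index H d.

Lemma card_vertex : #|vertex H| = d.
Proof. by rewrite -cardfE (card_fset_set Hd). Qed.

Lemma coset_in_vertex u : right_coset H u \in fset_set (right_cosets H).
Proof. by rewrite in_fset_set ?inE; [exists u|exists d]. Qed.

Definition coset_vertex u : vertex H := [` coset_in_vertex u]%fset.

Lemma coset_vertexP C : exists u, C = coset_vertex u.
Proof.
have := valP C; rewrite in_fset_set; last by exists d.
by rewrite inE => -[u _ uC]; exists u; apply: val_inj.
Qed.

Lemma transition_coset_vertex u v :
  transition_perm H u (coset_vertex v) = coset_vertex (v * u).
Proof. by rewrite permE; apply: val_inj; rewrite /= right_cosetM. Qed.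

Lemma coset_vertex_eq u v : coset_vertex u = coset_vertex v <-> right_coset H v u.
Proof.
rewrite -right_coset_eq; split=> [/(congr1 val) //|uv]; exact: val_inj.
Qed.

End FiniteIndex.
End Subgroup.

(** [H] is the stabiliser of the vertex [H] in the transitive action on its cosets, so [schreier]
    applies. *)
Lemma finite_index_free n d (H : set (free_group n)) :
  is_subgroup H -> has_index H d ->
  exists k, (k + d = d * n + 1)%N /\
  exists (phi : free_group n -> free_group k) (psi : free_group k -> free_group n),
  [/\ {in H &, {morph phi : u v / u * v}}, {morph psi : u v / u * v},
      forall v, H (psi v), cancel psi phi & {in H, cancel phi psi}].
Proof.
move=> Hgrp Hd; set x0 := coset_vertex Hd 1.
have stabE u : transition_perm H u x0 = x0 <-> H u.
  by rewrite transition_coset_vertex mul1g (coset_vertex_eq Hgrp) right_coset1.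
have trans x : exists u, transition_perm H u x0 = x.
  have [u ->] := coset_vertexP Hd x.
  by exists u; rewrite transition_coset_vertex mul1g.
have [k [kE [phi [psi [phiM psiM psiH psiK phiK]]]]] :=
  schreier (@transition_permM _ H) trans.
rewrite (card_vertex Hd) in kE.
exists k; split=> //; exists phi, psi; split=> // [u v Hu Hv|v|u Hu].
- by apply: phiM; apply/stabE; rewrite inE in Hu.
- exact/stabE.
- by apply: phiK; apply/stabE; rewrite inE in Hu.
Qed.

Lemma isomorphic_same_index n d (H K : set (free_group n)) :
  is_subgroup H -> is_subgroup K -> has_index H d -> has_index K d ->
  isomorphic H K.
Proof.
move=> Hgrp Kgrp Hd Kd.
have [k [kE [phi [psi [phiM psiM psiH psiK phiK]]]]] := finite_index_free Hgrp Hd.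
have [l [lE]] := finite_index_free Kgrp Kd.
(* The index determines the rank. *)
have {l lE} -> : l = k by apply: (@addIn d); rewrite lE kE.
move=> [phi' [psi' [phi'M psi'M psi'K psi'K' phi'K]]].
exists (psi' \o phi); last by move=> u v Hu Hv /=; rewrite phiM // psi'M.
split=> [u Hu|u v Hu Hv /(can_inj psi'K') uv|u Ku].
- exact: psi'K.
- by rewrite -(phiK u Hu) uv phiK.
by exists (psi (phi' u)) => //=; rewrite psiK phi'K // inE.
Qed.

Theorem theorem1 (n s : nat) (H : 'I_s.+1 -> set (free_group n))
    (alpha : 'I_s.+1 -> free_group n) (d : 'I_s.+1 -> nat) :
  (2 <= n)%N ->
  (forall i, is_subgroup (H i)) ->
  (forall i, has_index (H i) (d i)) ->
  partition setT (fun i => right_coset (H i) (alpha i)) setT ->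
  (1 < d ord0)%N ->
  {homo d : i j / (i <= j)%N} ->
  (exists2 t, t \in transition_group (H ord_max) & is_cycle (d ord_max) t) ->
  (pdiv (d ord_max) <= #|[pred i | d i == d ord_max]|)%N /\
  (forall i j, d i = d j -> isomorphic (H i) (H j)).
Proof.
move=> _ Hgrp Hd [cover disj _] d0_gt1 d_homo [t + t_cycle].
rewrite finset.in_set => /asboolP[w _ wt]; split; last first.
  move=> i j dij; apply: (isomorphic_same_index (d := d i)) => //.
  by rewrite dij.
have d_le i : d i <= d ord_max by apply: d_homo; rewrite -ltnS.
pose pi i := transition_perm (H i) w.
pose b i := coset_vertex (Hd i) 1.
pose a i := coset_vertex (Hd i) (alpha i).
pose m i := #|porbit (pi i) (b i)|.
have m_le i : m i <= d i by rewrite -(card_vertex (Hd i)) max_card.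
have m_gt0 i : 0 < m i by rewrite lt0n card_porbit_neq0.
have pi_expg i k : (pi i ^+ k) (b i) = coset_vertex (Hd i) (w ^+ k).
  elim: k => [|k IHk]; first by rewrite perm1.
  by rewrite !expgSr permM IHk transition_coset_vertex.
have hit i k : (pi i ^+ k) (b i) = a i <-> right_coset (H i) (alpha i) (w ^+ k).
  by rewrite pi_expg; apply: coset_vertex_eq.
(* The cosets that contain some power of [w]; outside [A] the value [r i] is arbitrary. *)
pose A := [set i | a i \in porbit (pi i) (b i)]%SET.
have rP i : exists r, i \in A -> (pi i ^+ r) (b i) = a i.
  have [|nAi] := boolP (i \in A); last by exists 0%N.
  by rewrite finset.in_set => /porbitP[r ->]; exists r.
pose r i := projT1 (cid (rP i)).
have rE i : i \in A -> (pi i ^+ r i) (b i) = a i by rewrite /r; case: cid.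
have hitE i x : (i \in A) && (x == r i %[mod m i]) = ((pi i ^+ x) (b i) == a i).
  have [Ai|nAi] := boolP (i \in A).
    by rewrite -[a i]rE // porbit_expgE.
  apply/esym/negbTE; apply: contra nAi => /eqP xa.
  by rewrite finset.in_set -xa mem_porbit.
have mE : m ord_max = d ord_max.
  rewrite -(card_vertex (Hd ord_max)); apply: card_cycle_porbit.
  by rewrite (card_vertex (Hd ord_max)) /pi wt.
have A_max : ord_max \in A.
  rewrite finset.in_set.
  suff -> : porbit (pi ord_max) (b ord_max) = [set: vertex (H ord_max)]%SET
    by rewrite finset.in_setT.
  apply/eqP; rewrite eqEcard finset.subsetT cardsT.
  by rewrite (card_vertex (Hd ord_max)) -mE leqnn.
(* Divisibility gives [m ord_max <= m i], while [m i <= d i <= d ord_max = m ord_max]. *)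
have m_max i : i \in A -> m ord_max %| m i -> m i = m ord_max.
  move=> _ /dvdn_leq - /(_ (m_gt0 i)) m_ge; apply/eqP.
  by rewrite eqn_leq m_ge mE (leq_trans (m_le i)).
have cov x : #|[pred i in A | x == r i %[mod m i]]| = 1%N.
  have : [set: free_group n]%classic (w ^+ x) by [].
  rewrite -cover => -[i _ xi].
  rewrite -(card1 i); apply: eq_card => j; rewrite -!topredE /= hitE.
  apply/eqP/eqP => [/hit xj|->]; last exact/hit.
  by apply: disj => //; exists (w ^+ x).
have := @disjoint_cover_max_modulus _ A m r ord_max (fun i _ => m_gt0 i) cov A_max.
rewrite mE => /(_ _ _)/leq_trans; apply=> //.
- by apply: leq_trans d0_gt1 (d_le _).
- by move=> i Ai; rewrite -mE; apply: m_max.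
(* A class of modulus [d ord_max] comes from a subgroup of that index, as
   [m i <= d i <= d ord_max]. *)
apply: subset_leq_card; apply/fintype.subsetP => i; rewrite !inE => /andP[_ /eqP mi].
by rewrite eqn_leq d_le -mi m_le.
Qed.
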